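(* Let $X$ be a real Banach space and let $f:[a,b]\to X$. If $md(f,\cdot)$ is continuous at $x\in[a,b]$, and $x$ is a bilaterally metrically regular point of $f$, then $f$ is metrically differentiable at $x$.
   Context: For $f:[a,b]\to X$, the unilateral metric derivatives are $md_{\pm}(f,x)=\lim_{t\to0+}\frac{\|f(x\pm t)-f(x)\|}{t}$. If both exist and are equal (and finite), their common value is the metric derivative $md(f,x)$; at an endpoint of $[a,b]$ only the one-sided limit taken inside $[a,b]$ is used. ''$md(f,\cdot)$ is continuous at $x$'' means that $md(f,s)$ exists for all $s\in[a,b]$ in some neighbourhood of $x$ and $md(f,s)\to md(f,x)$ as $s\to x$, $s\in[a,b]$. The mapping $f$ is metrically differentiable at $x$ if $md(f,x)$ exists and $\|f(y)-f(z)\|-md(f,x)|y-z|=o(|y-x|+|z-x|)$ as $(y,z)\to(x,x)$ with $y,z\in[a,b]$. $\bigvee_y^z f$ denotes the total variation of $f$ on $[y,z]$. A point $x\in[a,b]$ is a bilaterally metrically regular point of $f$ if $\frac{\|f(y)-f(z)\|}{\bigvee_y^z f}\to1$ as $(y,z)\to(x,x)$ with $a\le y\le x\le z\le b$, $(y,z)\ne(x,x)$ (in particular the denominator is nonzero for all such $(y,z)$ close to $(x,x)$). *)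

(* Defs.v *)
From HB Require Import structures.
From mathcomp Require Import all_boot all_order all_algebra.
From mathcomp Require Import all_classical all_reals all_analysis.

Set Implicit Arguments.
Unset Strict Implicit.
Unset Printing Implicit Defensive.

Import Order.TTheory GRing.Theory Num.Theory.
Import numFieldNormedType.Exports.

Local Open Scope classical_set_scope.
Local Open Scope ring_scope.

(* A map [a, b] -> X is represented by a total map f : R -> X; the notions
   below depend only on the values of f on [a, b]. *)

Section metric_derivative.
Context {R : realType} {X : normedModType R}.
Implicit Types (f : R -> X) (a b x l : R).

Definition is_md_right f x l :=
  `|f (x + t) - f x| / t @[t --> 0^'+] --> l.

Definition is_md_left f x l :=
  `|f (x - t) - f x| / t @[t --> 0^'+] --> l.

(* For a < b at least one of the two guards holds, so the (finite) value l is
   unique when it exists. *)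
Definition is_md a b f x l :=
  [/\ x \in `[a, b], x < b -> is_md_right f x l & a < x -> is_md_left f x l].

Definition ex_md a b f x := exists l, is_md a b f x l.

(* Meaningful only when ex_md a b f x holds; unspecified otherwise. *)
Definition md a b f x : R := get (is_md a b f x).

Definition md_continuous_at a b f x :=
  (\forall s \near within `[a, b] (nbhs x), ex_md a b f s) /\
  md a b f s @[s --> within `[a, b] (nbhs x)] --> md a b f x.

Definition metrically_differentiable a b f x :=
  ex_md a b f x /\
  let F := within (`[a, b] `*` `[a, b]) (nbhs (x, x)) in
  (fun p : R * R => `|f p.1 - f p.2| - md a b f x * `|p.1 - p.2|)
    =o_F (fun p : R * R => `|p.1 - x| + `|p.2 - x|).

End metric_derivative.

Section regular_points.
Context {R : realType} {X : normedModType R}.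
Implicit Types (f : R -> X) (a b x y z : R).

(* The library's variation and total_variation only cover R-valued maps; these
   are the same definitions with the norm of X, over the same partitions. *)
Definition nvariation y z f (s : seq R) : R :=
  \sum_(0 <= n < size s) `|f (nth z (y :: s) n.+1) - f (nth z (y :: s) n)|.

Definition total_nvariation y z f : \bar R :=
  ereal_sup [set (nvariation y z f s)%:E | s in [set s | itv_partition y z s]].

(* The quotient is taken in \bar R, where r / +oo = 0 for finite r: an infinite
   total variation is incompatible with the limit 1. *)
Definition bilaterally_metrically_regular a b f x :=
  x \in `[a, b] /\
  let F := within [set p : R * R | [/\ a <= p.1 <= x, x <= p.2 <= b
                                     & p != (x, x)]] (nbhs (x, x)) in
  (\forall p \near F, total_nvariation p.1 p.2 f != 0%E) /\
  (`|f p.1 - f p.2|%:E / total_nvariation p.1 p.2 f)%E @[p --> F] --> 1%E.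

End regular_points.

(* Main.v *)
(** Let [m] be the metric derivative at [x].  The upper bound on
    [`|f y - f z|] is a mean value inequality, since the metric derivative is
    at most [m + e] near [x].  For the lower bound, existence of [m] gives
    [`|f y - f x| = m * `|y - x| + o(y - x)], and the triangle inequality
    suffices when [y] and [z] lie on the same side of [x].  On opposite sides
    regularity enters: [`|f y - f z|] is almost the total variation between [y]
    and [z], which is at least [`|f y - f x| + `|f x - f z|]. *)
Require Import Defs.
From mathcomp Require Import all_boot all_order all_algebra.
From mathcomp Require Import all_classical all_reals all_analysis.
From mathcomp Require Import lra.

Set Implicit Arguments.
Unset Strict Implicit.
Unset Printing Implicit Defensive.

Import Order.TTheory GRing.Theory Num.Theory.
Import numFieldNormedType.Exports.
Local Open Scope classical_set_scope.
Local Open Scope ring_scope.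

Lemma md_right_near (R : realType) (X : normedModType R) (f : R -> X) (s l e : R) :
  0 < e -> is_md_right f s l ->
  exists2 d : R, 0 < d & forall t, s < t -> t < s + d ->
    `| `|f t - f s| - l * (t - s)| <= e * (t - s).
Proof.
move=> e0 /cvgrPdist_le /(_ _ e0); rewrite near_withinE => /nbhs_ballP[d /= d0 H].
exists d => // t st td.
have h0 : 0 < t - s by lra.
have := H (t - s); rewrite /ball /= sub0r normrN gtr0_norm // => /(_ _ h0).
have -> : s + (t - s) = t by lra.
move=> H1; have {}/H1 : t - s < d by lra.
rewrite distrC -(ler_pM2r h0) -{2}(gtr0_norm h0) -normrM mulrBl divfK //.
by rewrite gt_eqF.
Qed.

(** Reflection [t -> - t] turns a left derivative at [s] into a right derivative at [- s]. *)
Lemma md_left_near (R : realType) (X : normedModType R) (f : R -> X) (s l e : R) :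
  0 < e -> is_md_left f s l ->
  exists2 d : R, 0 < d & forall t, s - d < t -> t < s ->
    `| `|f t - f s| - l * (s - t)| <= e * (s - t).
Proof.
move=> e0 Hl.
have Hr : is_md_right (f \o -%R) (- s) l.
  move: Hl; rewrite /is_md_left /is_md_right /= => Hl.
  under eq_fun do rewrite opprD opprK.
  exact: Hl.
have [d d0 H] := md_right_near e0 Hr.
exists d => // t ? ?; have := H (- t); rewrite /= !opprK (addrC (- t)).
by apply; lra.
Qed.

Lemma is_md_near (R : realType) (X : normedModType R) (a b : R) (f : R -> X)
    (s l e : R) :
  0 < e -> is_md a b f s l ->
  exists2 d : R, 0 < d & forall t, t \in `[a, b] -> `|t - s| < d ->
    `| `|f t - f s| - l * `|t - s| | <= e * `|t - s|.
Proof.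
move=> e0 [sab Hr Hl].
have [d1 d10 H1] : exists2 d : R, 0 < d & forall t, s < t -> t < s + d -> t <= b ->
    `| `|f t - f s| - l * (t - s)| <= e * (t - s).
  (* At the endpoint [b] no [t] in the interval lies to the right of [s], so the radius 1 is
     arbitrary; likewise at [a] below. *)
  case: (ltP s b) => sb; last by exists 1 => // t ? ? ?; lra.
  have [d d0 H] := md_right_near e0 (Hr sb).
  by exists d => // t ? ? ?; apply: H.
have [d2 d20 H2] : exists2 d : R, 0 < d & forall t, s - d < t -> t < s -> a <= t ->
    `| `|f t - f s| - l * (s - t)| <= e * (s - t).
  case: (ltP a s) => sb; last by exists 1 => // t ? ? ?; lra.
  have [d d0 H] := md_left_near e0 (Hl sb).
  by exists d => // t ? ? ?; apply: H.
exists (Num.min d1 d2); first by rewrite lt_min d10.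
move=> t; rewrite in_itv /= => /andP[ta tb]; rewrite lt_min => /andP[].
have [ts|st|->] := ltgtP t s.
- by rewrite ltr0_norm ?subr_lt0// opprB => ? ?; apply: H2 => //; lra.
- by rewrite gtr0_norm ?subr_gt0// => ? ?; apply: H1 => //; lra.
- by rewrite !subrr !normr0 !mulr0 subrr normr0.
Qed.

(** Continuous induction: the set [A] of points reached from [y] with slope at most [C] contains its
    supremum, and the local bound there would carry it further unless the supremum is [z]. *)
Lemma mean_value_inequality (R : realType) (X : normedModType R) (f : R -> X)
    (C y z : R) :
  y <= z ->
  (forall s, s \in `[y, z] -> exists2 d : R, 0 < d &
    forall t, t \in `[y, z] -> `|t - s| < d -> `|f t - f s| <= C * `|t - s|) ->
  `|f z - f y| <= C * (z - y).
Proof.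
move=> yz loc.
pose A := [set t : R | t \in `[y, z] /\ `|f t - f y| <= C * (t - y)].
have Ay : A y by rewrite /A /= in_itv /= lexx yz !subrr normr0 mulr0.
have supA : has_sup A.
  split; first by exists y.
  by exists z => t -[]; rewrite in_itv /= => /andP[].
have ys : y <= sup A by apply: ub_le_sup => //; case: supA.
have sz : sup A <= z.
  by apply: ge_sup; [exists y|move=> t -[]; rewrite in_itv /= => /andP[]].
have extend u v : A u -> u <= v -> v <= z -> `|f v - f u| <= C * (v - u) -> A v.
  rewrite /A /= !in_itv /= => -[/andP[yu _] Pu] uv vz fuv.
  split; first by rewrite vz (le_trans yu).
  have := ler_distD (f u) (f v) (f y); lra.
have sI : sup A \in `[y, z] by rewrite in_itv /= ys.
have [d d0 Hd] := loc _ sI.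
(* A point of [A] within [d] to the left of the supremum is joined to it by the local bound. *)
have As : A (sup A).
  have [t At ts] := sup_adherent d0 supA.
  have tle : t <= sup A by apply: ub_le_sup => //; case: supA.
  apply: (extend t) => //.
  have := Hd t At.1; rewrite ler0_norm ?subr_le0// opprB distrC; apply; lra.
suff <- : sup A = z by exact: As.2.
apply/eqP; rewrite eq_le sz /=; case: (leP z (sup A)) => // sltz.
(* The same bound, used to the right, puts some [u] beyond the supremum into [A], a
   contradiction. *)
have [u su [uz ud]] : exists2 u, sup A < u & u <= z /\ u < sup A + d.
  case: (ltP (z - sup A) d) => h; first by exists z => //; split; lra.
  by exists (sup A + d / 2); [lra|split; lra].
have : A u.
  apply: (extend (sup A)) => //; first exact: ltW.
  have := Hd u; rewrite in_itv /= uz (le_trans ys (ltW su)) => /(_ isT).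
  rewrite gtr0_norm ?subr_gt0//; apply; lra.
move=> Au; have : u <= sup A by apply: ub_le_sup => //; case: supA.
by rewrite leNgt su.
Qed.

(** A single partition suffices, the one with interior point [x]. Partitions increase strictly and
    their lists omit the left endpoint [y]. *)
Lemma total_nvariation_ge_through (R : realType) (X : normedModType R)
    (f : R -> X) (y x z : R) : y < x -> x < z ->
  ((`|f y - f x| + `|f x - f z|)%:E <= total_nvariation y z f)%E.
Proof.
move=> yx xz; apply: ereal_sup_ubound; exists [:: x; z].
  by rewrite /itv_partition /= yx xz eqxx.
by rewrite /nvariation /= !big_nat_recr //= big_nil add0r distrC (distrC (f z)).
Qed.

Lemma bilaterally_metrically_regular_near (R : realType) (X : normedModType R)
    (a b : R) (f : R -> X) (x e : R) :
  0 < e -> e < 1 -> bilaterally_metrically_regular a b f x ->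
  exists2 d : R, 0 < d & forall y z, a <= y -> y < x -> x < z -> z <= b ->
    x - d < y -> z < x + d ->
    (1 - e) * (`|f y - f x| + `|f x - f z|) <= `|f y - f z|.
Proof.
move=> e0 e1 [xab [nz lim1]].
have lt1 : ((1 - e)%:E < 1%E)%E by rewrite lte_fin; lra.
have := lim1 _ (open_nbhs_nbhs (conj (@open_ereal_gt_ereal _ (1 - e)%:E) lt1)).
move/(filterI nz) => /nbhs_ballP[d /= d0 H].
exists d => // y z ay yx xz zb yd zd.
have [] := H (y, z).
- by split => /=; rewrite /ball /= ltr_distlC; lra.
- split => /=; [lra|lra|].
  by rewrite xpair_eqE negb_and lt_eqF.
move=> /= V0; have := total_nvariation_ge_through f yx xz.
(* The value [-oo] contradicts the lower bound on the variation. At [+oo] the quotient is 0, which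
   cannot exceed [1 - e] since [e < 1]. *)
case: (total_nvariation y z f) V0 => [r| |] V0 //=.
- rewrite lee_fin => vr.
  have r0 : 0 < r.
    have r0 : 0 <= r by apply: le_trans vr; rewrite addr_ge0.
    by rewrite lt_neqAle r0 eq_sym andbT; move: V0; rewrite eqe.
  rewrite inver gt_eqF // -EFinM lte_fin ltr_pdivlMr // => /ltW.
  by apply: le_trans; rewrite ler_wpM2l //; lra.
- by move=> _; rewrite invey mule0 lte_fin; lra.
Qed.

Unset Implicit Arguments.

Theorem lemma5p2 (R : realType) (X : completeNormedModType R) (a b : R)
    (f : R -> X) (x : R) (hab : a < b) (hx : x \in `[a, b])
    (hmd : md_continuous_at a b f x)
    (hreg : bilaterally_metrically_regular a b f x) :
  metrically_differentiable a b f x.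
Proof.
have [ex_near md_cvg] := hmd.
have mdP s : ex_md a b f s -> is_md a b f s (md a b f s) by move=> /getPex.
have ex_x : ex_md a b f x.
  by move: ex_near; rewrite near_withinE => /nbhs_singleton; apply.
split => //=; set m := md a b f x.
apply/eqoP => e e0.
(* The worst total error below is [k * |m| + k + k * k] per unit length; as [k <= 1], it is at most
   [k * (|m| + 2) <= e]. *)
pose k := Num.min (1 / 2) (e / (`|m| + 2)).
have m2 : 0 < `|m| + 2 by rewrite ltr_wpDl.
have k0 : 0 < k by rewrite lt_min !divr_gt0.
have k1 : k <= 1 / 2 by rewrite ge_min lexx.
have ke : k * (`|m| + 2) <= e by rewrite -ler_pdivlMr// ge_min lexx orbT.
have km0 : 0 <= k * `|m| by rewrite mulr_ge0 // ltW.
have km : - (k * `|m|) <= k * m <= k * `|m|.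
  by rewrite -ler_norml normrM gtr0_norm.
have [d1 d10 H1] := is_md_near k0 (mdP _ ex_x).
have klt1 : k < 1 by lra.
have [d2 d20 H2] := bilaterally_metrically_regular_near k0 klt1 hreg.
(* Only half of [k] is spent on the variation of the metric derivative; the other half pays for the
   local error at [s] in [mvi]. Existence is recorded as well, since [md] is unspecified without
   it. *)
have [d3 d30 H3] : exists2 d : R, 0 < d & forall s, s \in `[a, b] -> `|s - x| < d ->
    ex_md a b f s /\ md a b f s <= m + k / 2.
  have k20 : 0 < k / 2 by lra.
  move/cvgrPdist_le : md_cvg => /(_ _ k20) md_close.
  move/(filterI ex_near) : md_close => /nbhs_ballP[d /= d0 H].
  exists d => // s sab sd; have [|//|exs] := H s; first by rewrite /ball /= distrC.
  by rewrite ler_distlC -/m => ?; split => //; lra.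
have mvi y z : y <= z -> y \in `[a, b] -> z \in `[a, b] -> `|y - x| < d3 ->
    `|z - x| < d3 -> `|f z - f y| <= (m + k) * (z - y).
  rewrite !in_itv /= !ltr_distl => yz /andP[ay yb] /andP[az zb] yd zd.
  apply: mean_value_inequality => // s; rewrite in_itv /= => /andP[ys sz].
  have sab : s \in `[a, b] by rewrite in_itv /=; lra.
  have [|exs mds] := H3 _ sab; first by rewrite ltr_distl; lra.
  have k20 : 0 < k / 2 by lra.
  have [d d0 Hd] := is_md_near k20 (mdP _ exs).
  exists d => // t; rewrite in_itv /= => /andP[yt tz] td.
  have tab : t \in `[a, b] by rewrite in_itv /=; lra.
  have := Hd _ tab td; rewrite ler_norml => /andP[_].
  have : md a b f s * `|t - s| <= (m + k / 2) * `|t - s| by rewrite ler_wpM2r.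
  lra.
pose d := Num.min d1 (Num.min d2 d3).
have d0 : 0 < d by rewrite !lt_min d10 d20 d30.
have ordered y z : y <= z -> y \in `[a, b] -> z \in `[a, b] -> `|y - x| < d ->
    `|z - x| < d ->
    `| `|f y - f z| - m * (z - y)| <= e * (`|y - x| + `|z - x|).
  rewrite !lt_min => yz yab zab /and3P[yd1 yd2 yd3] /and3P[zd1 zd2 zd3].
  have := H1 _ yab yd1; have := H1 _ zab zd1; rewrite -/m.
  have := mvi _ _ yz yab zab yd3 zd3; rewrite distrC.
  move: (ler_distD (f x) (f y) (f z)) (ler_distD (f y) (f x) (f z))
    (ler_distD (f z) (f y) (f x)).
  rewrite (distrC (f x) (f z)) (distrC (f x) (f y)).
  set Y := `|f y - f x|; set Z := `|f z - f x|; set D := `|f y - f z|.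
  move=> DYZ ZYD YDZ Dle; rewrite !ler_norml => Zm Ym.
  have eu u : 0 <= u -> k * `|m| * u + k * 2 * u <= e * u.
    by move=> u0; rewrite -!mulrDl -mulrDr ler_wpM2r.
  have kmu u : 0 <= u -> 0 <= k * `|m| * u by move=> ?; rewrite mulr_ge0.
  have ku u : 0 <= u -> 0 <= k * u by move=> ?; rewrite mulr_ge0 // ltW.
  (* On one side of [x], [D] is at least the difference of [Y] and [Z], whose errors add up to
     [k * (|y - x| + |z - x|)]. *)
  have [xy|yx] := leP x y.
    have y0 : 0 <= y - x by lra.
    have z0 : 0 <= z - x by lra.
    move: Ym Zm; rewrite !ger0_norm //.
    move: (eu _ y0) (kmu _ y0) (ku _ y0) (eu _ z0) (kmu _ z0) (ku _ z0); lra.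
  have y0 : 0 <= x - y by lra.
  have [zx|xz] := leP z x.
    have z0 : 0 <= x - z by lra.
    move: Ym Zm; rewrite (distrC y) (distrC z) !ger0_norm //.
    move: (eu _ y0) (kmu _ y0) (ku _ y0) (eu _ z0) (kmu _ z0) (ku _ z0); lra.
  have z0 : 0 <= z - x by lra.
  move: yab zab yd2 zd2; rewrite !in_itv /= => /andP[ay _] /andP[_ zb].
  rewrite !ltr_distl => /andP[yd2 _] /andP[_ zd2].
  have := H2 _ _ ay yx xz zb yd2 zd2; rewrite (distrC (f x)) -/Y -/Z -/D => HD.
  move: Ym Zm; rewrite (distrC y) !ger0_norm // => Ym Zm.
  have u0 : 0 <= z - y by lra.
  (* On opposite sides, [z - y] equals [|y - x| + |z - x|]. Regularity loses [k * (Y + Z)], at most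
     [(k * |m| + k * k) * (z - y)], and passing from [Y + Z] to [m * (z - y)] loses another
     [k * (z - y)]. *)
  have YZ : k * (Y + Z) <= k * ((m + k) * (z - y)).
    by rewrite ler_wpM2l ?(ltW k0) //; lra.
  have mu : k * m * (z - y) <= k * `|m| * (z - y) by rewrite ler_wpM2r //; lra.
  have kku : k * (k * (z - y)) <= 1 * (k * (z - y)).
    by rewrite ler_wpM2r ?ku //; lra.
  move: (eu _ u0) (kmu _ u0) (ku _ u0); lra.
rewrite near_withinE; apply/nbhs_ballP; exists d => // -[y z] [/= yd zd] [/= yab zab].
move: yd zd; rewrite /ball /= !(distrC x) => yd zd.
rewrite (@ger0_norm _ (`|y - x| + `|z - x|)) ?addr_ge0 //.
(* The estimate is symmetric in [y] and [z], so the ordered case suffices. *)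
have [yz|/ltW zy] := leP y z.
  by rewrite (distrC y z) (@ger0_norm _ (z - y)) ?subr_ge0 //; exact: ordered.
rewrite (@ger0_norm _ (y - z)) ?subr_ge0 // (distrC (f y)) (addrC `|y - x|).
exact: ordered.
Qed.
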